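(* Let $1/3\le p<1$. Define a sequence $(\mu_n)_{n\ge1}$ by $$\mu_1=\left(\frac{1-p}{p}\right)^p,\qquad \mu_{n+1}=(n+1)^p\left(n^{p/(p-1)}\mu_n^{1/(1-p)}-1\right)^{1-p}+\left(\frac{1-p}{p}\right)^p,\quad n\ge1.$$ If there exists an integer $n_0\ge1$ such that $$\mu_{n_0}\ge\left(\frac{p}{1-p}\right)^{1-p}n_0+\frac12\left(\frac1p-1\right)^p,$$ then the inequality $$\sum_{n=1}^\infty\left(\frac1n\sum_{k=n}^\infty x_k\right)^p\ge C_p\sum_{n=1}^\infty x_n^p$$ holds for all sequences $(x_n)_{n\ge1}$ of positive real numbers with $C_p=(p/(1-p))^p$, and this constant is best possible.
   Context: Standing assumption: all infinite sums appearing are assumed to converge. ''Best possible'' means that the inequality fails for some admissible sequence if $C_p$ is replaced by any larger constant. Real powers are taken of nonnegative bases only: the recursion is understood to be defined as long as $n^{p/(p-1)}\mu_n^{1/(1-p)}-1\ge0$, and the hypothesis on $n_0$ presupposes that $\mu_1,\dots,\mu_{n_0}$ are all defined. *)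

(* Defs.v *)
From HB Require Import structures.
From mathcomp Require Import all_boot all_order all_algebra.
From mathcomp Require Import all_classical all_reals all_analysis.
Set Implicit Arguments.
Unset Strict Implicit.
Unset Printing Implicit Defensive.
Import Order.TTheory GRing.Theory Num.Theory.
Import numFieldNormedType.Exports.
Local Open Scope classical_set_scope.
Local Open Scope ring_scope.

(* Sequences are indexed from 1: the value of a sequence at 0 is never used. *)

Definition mu_radicand (R : realType) (p : R) (n : nat) (m : R) : R :=
  n%:R `^ (p / (p - 1)) * m `^ (1 / (1 - p)) - 1.

(* The value at 0 is a dummy.  This total version agrees with the partial
   sequence of real powers of nonnegative bases only where mu_defined holds. *)
Fixpoint mu (R : realType) (p : R) (n : nat) : R :=
  match n with
  | 0%N => 0
  | m.+1 =>
    match m with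
    | 0%N => ((1 - p) / p) `^ p
    | _ => m.+1%:R `^ p * mu_radicand p m (mu p m) `^ (1 - p)
           + ((1 - p) / p) `^ p
    end
  end.

(* mu_1, ..., mu_n are all defined.  For 0 < p < 1, mu p n > 0 for n >= 1, so
   mu_radicand is the only base whose sign is in question. *)
Definition mu_defined (R : realType) (p : R) (n : nat) : Prop :=
  forall m : nat, (1 <= m < n)%N -> 0 <= mu_radicand p m (mu p m).

Definition tail_mean (R : realType) (x : nat -> R) (n : nat) : R :=
  1 / n%:R * limn (fun N => \sum_(n <= k < N) x k).

Definition admissible (R : realType) (p : R) (x : nat -> R) : Prop :=
  [/\ forall n : nat, (1 <= n)%N -> 0 < x n,
      forall n : nat, (1 <= n)%N -> cvgn (fun N => \sum_(n <= k < N) x k),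
      cvgn (fun N => \sum_(1 <= n < N) tail_mean x n `^ p)
    & cvgn (fun N => \sum_(1 <= n < N) x n `^ p)].

Definition tail_inequality (R : realType) (p C : R) (x : nat -> R) : Prop :=
  limn (fun N => \sum_(1 <= n < N) tail_mean x n `^ p)
    >= C * limn (fun N => \sum_(1 <= n < N) x n `^ p).

(* Main.v *)
Require Import Defs.
From HB Require Import structures.
From mathcomp Require Import all_boot all_order all_algebra.
From mathcomp Require Import all_classical all_reals all_analysis.
Import Order.TTheory GRing.Theory Num.Theory.
Import numFieldNormedType.Exports.
From mathcomp Require Import ring lra.
Set Implicit Arguments.
Unset Strict Implicit.
Unset Printing Implicit Defensive.
Local Open Scope classical_set_scope.
Local Open Scope ring_scope.

(** Put q = p/(1-p), c = ((1-p)/p)^p = 1/C_p, let A_n be the tail sums of x and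
    T_n = A_n/n the tail means.

    The inequality.  One proves, for suitable coefficients m_N >= 0,
      sum_(n < N) x_n^p + m_N T_N^p <= c sum_(n <= N) T_n^p,
    which gives the theorem as N tends to infinity.  For N = 1 it is an equality
    with m_1 = c.  To go from N to N+1, split A_N = x_N + A_(N+1): by Hoelder
    ([powR_hoelder_step]), x^p + b y^p <= a (x+y)^p as soon as
    a^(1/(1-p)) = 1 + b^(1/(1-p)), and the largest coefficient m_(N+1) obtained in
    this way is the one prescribed by the recursion of mu ([mu_next_step]).  So mu
    works for as long as it is defined.  The hypothesis says that, at n0, mu is at
    least the affine sequence lam_n = q^(1-p) (n + d) with d = 1/(2q).  From there on
    lam_n is used instead: the recursion applied to lam_n is defined and at least
    lam_(n+1) ([mu_next_ge]).  After simplification this is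
      n^(-q) (n+d)^(1+q) - (n+1)^(-q) (n+1-d)^(1+q) >= 2d        (2qd = 1),
    with d <= 1 because p >= 1/3.  The function a^(-q) b^(1+q) is homogeneous
    of degree 1, so on the line through the two points it becomes, after rescaling
    the midpoint to (1, 1), a function E(w) with the points at w and -w, and the
    claim reads E(w) - E(-w) >= 2 E'(0) w.  It holds because E''(-w) <= E''(w)
    ([ddline_powR_reflect_le], [line_powR_reflect_ge]).

    Optimality.  Take A_n = n^(-s) with s = (1+t)/p - 1, t > 0 small, that is
    x_n = n^(-s) - (n+1)^(-s).  Then T_n^p = n^(-1-t), while the tangent of x^(-s)
    at n+1 gives x_n^p >= s^p (n+1)^(-1-t).  With Z the sum of the n^(-1-t), the
    ratio of the two sides is at most Z / (s^p (Z-1)), which as t -> 0 tends to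
    (1/p - 1)^(-p) = C_p since Z >= 1/t is unbounded ([tail_constant_optimal]). *)

(** * Odd part of a homogeneous function along a line *)

Lemma ge0_of_derive_ge0 (R : realType) (f df : R -> R) (b : R) :
  (forall x, 0 <= x < b -> is_derive x 1 f (df x)) ->
  (forall x, 0 <= x < b -> 0 <= df x) -> 0 <= f 0 ->
  forall x, 0 <= x < b -> 0 <= f x.
Proof.
move=> fdf df0 f0 x /andP[x0 xb].
have [||c c0x fE] := @MVT_segment R f df 0 x x0.
- move=> y; rewrite in_itv/= => /andP[y0 yx]; apply: fdf.
  by rewrite (ltW y0) (lt_trans yx).
- apply: derivable_within_continuous => y; rewrite in_itv/= => /andP[y0 yx].
  by apply: (@ex_derive _ _ _ _ _ _ (df y)); apply: fdf; rewrite y0 (le_lt_trans yx).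
rewrite -[f x](subrK (f 0)) fE subr0 addr_ge0// mulr_ge0// df0//.
by move: c0x; rewrite in_itv/= => /andP[-> cx]; rewrite (le_lt_trans cx).
Qed.

(** The slope of the point (1 - w, 1 + k w) of the line through (1, 1) with
    direction (-1, k). *)
Definition mobius (R : realType) (k w : R) : R := (1 + k * w) / (1 - w).

Lemma mobius_gt0 (R : realType) (k w : R) : `|k| <= 1 -> `|w| < 1 ->
  0 < mobius k w.
Proof.
move=> k1 w1; have kw : `|k * w| < 1.
  by rewrite normrM (le_lt_trans _ w1)// ler_piMl.
move: w1 kw; rewrite !ltr_norml => /andP[w1 w2] /andP[w3 w4].
by rewrite /mobius divr_gt0//; lra.
Qed.

Lemma is_derive_mobius (R : realType) (k w : R) : w != 1 ->
  is_derive w 1 (mobius k) ((1 + k) / (1 - w) ^+ 2).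
Proof.
move=> w1; have w10 : 1 - w != 0 by rewrite subr_eq0 eq_sym.
have -> : mobius k = (fun x => 1 + k * x) * (fun x => (1 - x)^-1).
  by apply/funext => x.
have dV : is_derive w 1 (fun x : R => (1 - x)^-1) (- (1 - w) ^- 2 *: - 1).
  apply: (@is_deriveV _ (fun x : R => 1 - x)) => //.
  by apply: is_derive_eq; rewrite add0r mul1r.
apply: is_derive_eq.
rewrite /= /GRing.scale /=; field.
exact: w10.
Qed.

Lemma is_derive_powR_comp (R : realType) (f : R -> R) (df a w : R) :
  is_derive w 1 f df -> 0 < f w ->
  is_derive w 1 (fun x => f x `^ a) (a * f w `^ (a - 1) * df).
Proof.
move=> fdf fw0; have dp := is_derive1_powR a fw0.
exact: (@is_derive1_comp _ (fun y => y `^ a) f w _ _ dp fdf).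
Qed.

Lemma is_derive_reflect (R : realType) (f : R -> R) (df w : R) :
  is_derive (- w) 1 f df -> is_derive w 1 (fun x => f (- x)) (- df).
Proof.
move=> fdf; rewrite -mulrN1.
exact: (@is_derive1_comp _ f (fun y => - y) w _ _ fdf).
Qed.

(** The restriction of (a, b) |-> a^(-q) b^(1+q), homogeneous of degree 1, to
    the line a = 1 - w, b = 1 + k w. *)
Definition line_powR (R : realType) (k q w : R) := (1 - w) * mobius k w `^ (1 + q).

(** The derivative of [line_powR] in w; it depends on w through the slope only,
    since mobius k w + k = (1 + k) / (1 - w). *)
Definition dline_powR (R : realType) (k q w : R) :=
  q * mobius k w `^ (1 + q) + k * (1 + q) * mobius k w `^ q.

(** The second derivative of [line_powR] in w when q (1 + k) = 1. *)
Definition ddline_powR (R : realType) (k q w : R) :=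
  (1 + q) * (1 + k) * mobius k w `^ (q - 1) / (1 - w) ^+ 3.

Lemma norm_le1_of_itv (R : realType) (k : R) : -1 < k <= 1 -> `|k| <= 1.
Proof. by case/andP=> k2 k3; rewrite ler_norml (ltW k2). Qed.

Lemma exponent_gt0 (R : realType) (k q : R) : -1 < k <= 1 -> q * (1 + k) = 1 -> 0 < q.
Proof.
case/andP=> k2 _ qE; have : 0 < q * (1 + k) by rewrite qE.
by rewrite pmulr_lgt0//; lra.
Qed.

Lemma exponentM (R : realType) (k q : R) : q * (1 + k) = 1 -> q * k = 1 - q.
Proof. by rewrite mulrDr mulr1 => <-; ring. Qed.

Lemma is_derive_line_powR (R : realType) (k q w : R) :
  -1 < k <= 1 ->
  `|w| < 1 -> is_derive w 1 (line_powR k q) (dline_powR k q w).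
Proof.
move=> k1 w1; have k_norm := norm_le1_of_itv k1.
have r0 := mobius_gt0 k_norm w1.
have wn1 : w != 1 by apply: contraTneq w1 => ->; rewrite normr1 ltxx.
have dr := is_derive_powR_comp (1 + q) (is_derive_mobius k wn1) r0.
have -> : line_powR k q = (fun x => 1 - x) * (fun x => mobius k x `^ (1 + q)).
  by apply/funext.
apply: is_derive_eq.
rewrite /= /GRing.scale /= /dline_powR (_ : 1 + q - 1 = q); last by ring.
rewrite powRD ?(gt_eqF r0) ?implybT// powRr1 ?(ltW r0)//.
have w10 : 1 - w != 0 by rewrite subr_eq0 eq_sym.
rewrite /mobius; set z := _ `^ q; field.
exact: w10.
Qed.

Lemma is_derive_dline_powR (R : realType) (k q w : R) :
  -1 < k <= 1 -> q * (1 + k) = 1 ->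
  `|w| < 1 -> is_derive w 1 (dline_powR k q) (ddline_powR k q w).
Proof.
move=> k1 qE w1; have k_norm := norm_le1_of_itv k1; have qkE := exponentM qE.
have r0 := mobius_gt0 k_norm w1.
have wn1 : w != 1 by apply: contraTneq w1 => ->; rewrite normr1 ltxx.
have dr a := is_derive_powR_comp a (is_derive_mobius k wn1) r0.
have dr1 := dr (1 + q); have drq := dr q.
have -> : dline_powR k q = q \*: (fun x => mobius k x `^ (1 + q)) +
                   (k * (1 + q)) \*: (fun x => mobius k x `^ q).
  by apply/funext.
apply: is_derive_eq.
rewrite /= /GRing.scale /= /ddline_powR (_ : 1 + q - 1 = 1 + (q - 1)); last by ring.
rewrite [_ `^ (1 + (q - 1))]powRD ?(gt_eqF r0) ?implybT// powRr1 ?(ltW r0)//.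
have w10 : 1 - w != 0 by rewrite subr_eq0 eq_sym.
rewrite /mobius; set z := _ `^ (q - 1); field: qkE.
exact: w10.
Qed.

(** Up to the positive factor (1+q)(1+k), with M := mobius k, the claim is
    M(-w)^(q-1) / (1+w)^3 <= M(w)^(q-1) / (1-w)^3.  Since M(-w) <= M(w) and q > 0,
    raising to the power q keeps the order, and what is left is the rational
    inequality M(w) (1-w)^3 <= M(-w) (1+w)^3, whose defect is
    2w ((1-k)(1+w^2) + (1-w^2)).  This is where k <= 1 enters. *)
Lemma ddline_powR_reflect_le (R : realType) (k q w : R) :
  -1 < k <= 1 -> q * (1 + k) = 1 ->
  0 <= w < 1 -> ddline_powR k q (- w) <= ddline_powR k q w.
Proof.
move=> k1 qE /andP[w0 w1]; have k_norm := norm_le1_of_itv k1.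
have q_gt0 := exponent_gt0 k1 qE; case/andP: (k1) => k2 k3.
have nw : `|w| < 1 by rewrite ger0_norm.
have nNw : `|- w| < 1 by rewrite normrN.
have a0 := mobius_gt0 k_norm nw; have b0 := mobius_gt0 k_norm nNw.
have ba : mobius k (- w) <= mobius k w.
  rewrite /mobius opprK mulrN ler_pdivrMr; last by lra.
  by rewrite mulrAC ler_pdivlMr; last lra; nra.
have baq : mobius k (- w) `^ q <= mobius k w `^ q.
  by apply: ge0_ler_powR => //; rewrite ?nnegrE ltW.
have ab3 : mobius k w * (1 - w) ^+ 3 <= mobius k (- w) * (1 + w) ^+ 3.
  have -> : mobius k w * (1 - w) ^+ 3 = (1 + k * w) * (1 - w) ^+ 2.
    by rewrite /mobius; field; rewrite gt_eqF//; lra.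
  have -> : mobius k (- w) * (1 + w) ^+ 3 = (1 - k * w) * (1 + w) ^+ 2.
    by rewrite /mobius; field; rewrite gt_eqF//; lra.
  rewrite -subr_ge0.
  have -> : (1 - k * w) * (1 + w) ^+ 2 - (1 + k * w) * (1 - w) ^+ 2 =
            2 * w * ((1 - k) * (1 + w ^+ 2) + (1 - w ^+ 2)) by ring.
  apply: mulr_ge0; first by lra.
  apply: addr_ge0; last by nra.
  by apply: mulr_ge0; nra.
have powB r : 0 < r -> r `^ (q - 1) = r `^ q / r.
  by move=> r0; rewrite powRB ?(gt_eqF r0) ?implybT// powRr1// ltW.
have q10 : 0 < 1 + q by lra.
have w10 : 0 < 1 - w by lra.
have w11 : 0 < 1 + w by lra.
have k10 : 0 < 1 + k by lra.
rewrite /ddline_powR !powB// opprK -!mulrA !ler_pM2l//.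
rewrite -!invfM !ler_pM ?invr_ge0 ?powR_ge0//.
  by rewrite mulr_ge0 ?exprn_ge0 ?(ltW b0) ?(ltW w11).
rewrite lef_pV2 ?posrE; [exact: ab3 | |]; by rewrite mulr_gt0 ?exprn_gt0.
Qed.

Lemma dline_powR0 (R : realType) (k q : R) : q * (1 + k) = 1 -> dline_powR k q 0 = 1 + k.
Proof.
move=> /exponentM qkE; rewrite /dline_powR /mobius mulr0 addr0 subr0 divr1 powR1 !mulr1.
by rewrite mulrDr mulr1 (mulrC k) qkE; ring.
Qed.

Lemma dline_powR_reflect_ge (R : realType) (k q w : R) :
  -1 < k <= 1 -> q * (1 + k) = 1 ->
  0 <= w < 1 -> 2 * (1 + k) <= dline_powR k q w + dline_powR k q (- w).
Proof.
move=> k1 qE; have normN (x : R) : 0 <= x < 1 -> `|x| < 1 /\ `|- x| < 1.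
  by move=> /andP[x0 x1]; rewrite normrN ger0_norm.
move=> w01; rewrite -subr_ge0; move: w w01.
apply: (@ge0_of_derive_ge0 _
  (fun x => dline_powR k q x + dline_powR k q (- x) - 2 * (1 + k))
  (fun x => ddline_powR k q x - ddline_powR k q (- x))).
- move=> x /normN[x1 Nx1].
  have d1 := is_derive_dline_powR k1 qE x1.
  have d2 := is_derive_reflect (is_derive_dline_powR k1 qE Nx1).
  have -> : (fun x => dline_powR k q x + dline_powR k q (- x) - 2 * (1 + k)) =
    dline_powR k q + (fun x => dline_powR k q (- x)) + cst (- (2 * (1 + k))).
    by apply/funext.
  apply: is_derive_eq. by rewrite subr0.
- by move=> x x01; rewrite subr_ge0 ddline_powR_reflect_le.
- by rewrite oppr0 dline_powR0; lra.
Qed.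

(** With E := line_powR k q, the difference w |-> E(w) - E(-w) is convex on
    [0, 1), so it lies above its tangent at 0. *)
Lemma line_powR_reflect_ge (R : realType) (k q w : R) :
  -1 < k <= 1 -> q * (1 + k) = 1 ->
  0 <= w < 1 ->
  2 * (1 + k) * w <= line_powR k q w - line_powR k q (- w).
Proof.
move=> k1 qE; have normN (x : R) : 0 <= x < 1 -> `|x| < 1 /\ `|- x| < 1.
  by move=> /andP[x0 x1]; rewrite normrN ger0_norm.
move=> w01; rewrite -subr_ge0; move: w w01.
apply: (@ge0_of_derive_ge0 _
  (fun x => line_powR k q x - line_powR k q (- x) - 2 * (1 + k) * x)
  (fun x => dline_powR k q x + dline_powR k q (- x) - 2 * (1 + k))).
- move=> x /normN[x1 Nx1].
  have d1 := is_derive_line_powR q k1 x1.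
  have d2 := is_derive_reflect (is_derive_line_powR q k1 Nx1).
  have -> : (fun x => line_powR k q x - line_powR k q (- x) - 2 * (1 + k) * x) =
    line_powR k q - (fun x => line_powR k q (- x)) - (2 * (1 + k)) \*: id.
    by apply/funext.
  apply: is_derive_eq. by rewrite opprK /GRing.scale /= mulr1.
- by move=> x x01; rewrite subr_ge0 dline_powR_reflect_ge.
- by rewrite oppr0; lra.
Qed.

(** * The recursion and the affine lower bound *)

Lemma powR_inv (R : realType) (x a : R) : 0 <= x -> x^-1 `^ a = x `^ (- a).
Proof. by move=> x0; rewrite -powR_inv1// -powRrM mulN1r. Qed.

(** With H(a, b) = a^(-q) b^(1+q), the claim compares the values of H at (x, x+d)
    and (x+1, x+1-d).  Homogeneity rescales the midpoint of these points to
    (1, 1); they then sit at w and -w with w = 1/(2x+1), on the line of slope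
    parameter k = 2d - 1, and 2qd = 1 becomes q (1 + k) = 1. *)
Lemma ratio_powR_ge (R : realType) (d q x : R) :
  0 < d <= 1 -> 2 * q * d = 1 -> 0 < x ->
  2 * d + (x + 1) * ((x + 1 - d) / (x + 1)) `^ (1 + q) <=
  x * ((x + d) / x) `^ (1 + q).
Proof.
move=> /andP[d0 d1] qd x0.
have k1 : -1 < 2 * d - 1 <= 1 by apply/andP; split; lra.
have qE : q * (1 + (2 * d - 1)) = 1 by rewrite -[RHS]qd; ring.
have x21 : 0 < 2 * x + 1 by lra.
pose w := (2 * x + 1)^-1.
have w01 : 0 <= w < 1.
  by rewrite /w invr_ge0 (ltW x21)/= invf_lt1//; lra.
have := line_powR_reflect_ge k1 qE w01.
have xn0 : x != 0 by rewrite gt_eqF.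
have x1n0 : x + 1 != 0 by rewrite gt_eqF//; lra.
have x21n0 : 2 * x + 1 != 0 by rewrite gt_eqF.
have -> : line_powR (2 * d - 1) q w =
    2 / (2 * x + 1) * (x * ((x + d) / x) `^ (1 + q)).
  rewrite /line_powR; have -> : mobius (2 * d - 1) w = (x + d) / x.
    rewrite /mobius /w; field; apply/and3P.
    by split => //; rewrite gt_eqF//; lra.
  by rewrite mulrA; congr (_ * _); rewrite /w; field.
have -> : line_powR (2 * d - 1) q (- w) =
    2 / (2 * x + 1) * ((x + 1) * ((x + 1 - d) / (x + 1)) `^ (1 + q)).
  rewrite /line_powR; have -> : mobius (2 * d - 1) (- w) = (x + 1 - d) / (x + 1).
    rewrite /mobius /w; field; apply/and3P.
    by split => //; rewrite gt_eqF//; lra.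
  by rewrite mulrA; congr (_ * _); rewrite /w; field.
rewrite -mulrBr (_ : 2 * (1 + (2 * d - 1)) * w = 2 / (2 * x + 1) * (2 * d)); last first.
  by rewrite /w; field.
by rewrite ler_pM2l ?divr_gt0// lerBrDr.
Qed.

(** Hoelder's inequality for the vectors (1, t^(1-p)) and (x^p, y^p) with the
    conjugate exponents 1/(1-p) and 1/p. *)
Lemma powR_hoelder_step (R : realType) (p t x y : R) :
  0 < p < 1 -> 0 <= t -> 0 <= x -> 0 <= y ->
  x `^ p + t `^ (1 - p) * y `^ p <= (1 + t) `^ (1 - p) * (x + y) `^ p.
Proof.
move=> /andP[p0 p1] t0 x0 y0.
have e0 : 0 < 1 - p by rewrite subr_gt0.
have := @hoelder2 R 1 (t `^ (1 - p)) (x `^ p) (y `^ p) (1 - p)^-1 p^-1.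
rewrite powR1 mul1r -!powRrM !divff ?gt_eqF// !powRr1// !invrK.
by apply; rewrite ?powR_ge0 ?invr_gt0//; ring.
Qed.

(** With a := m / n^p, the coefficient of the tail sum in
    m * (tail sum / n)^p, the radicand is a^(1/(1-p)) - 1: exactly the t for which
    [powR_hoelder_step] has the constant (1 + t)^(1-p) = a. *)
Lemma mu_radicandE (R : realType) (p m : R) (n : nat) :
  p < 1 -> (0 < n)%N -> 0 <= m ->
  mu_radicand p n m + 1 = (m / n%:R `^ p) `^ (1 - p)^-1.
Proof.
move=> p1 n0 m0; rewrite /mu_radicand subrK div1r.
rewrite powRM ?invr_ge0 ?powR_ge0// mulrC powR_inv ?powR_ge0// -powRrM.
congr (_ * _ `^ _); field.
by rewrite !subr_eq0 (gt_eqF p1) (lt_eqF p1).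
Qed.

(** The recursion of [mu] as a map of the current value, so that it can also be
    applied to lower bounds of that value. *)
Definition mu_next (R : realType) (p : R) (n : nat) (m : R) : R :=
  n.+1%:R `^ p * mu_radicand p n m `^ (1 - p) + ((1 - p) / p) `^ p.

(** Here t and s stand for two consecutive tail means.  Hoelder's inequality is
    used in the form x^p + (radicand)^(1-p) y^p <= a (x + y)^p with y := (n+1) s and
    x + y = n t; the recursion adds exactly the new term c s^p on both sides. *)
Lemma mu_next_step (R : realType) (p m x t s : R) (n : nat) :
  0 < p < 1 -> (0 < n)%N -> 0 <= m -> 0 <= mu_radicand p n m ->
  0 <= x -> 0 <= s -> n%:R * t = x + n.+1%:R * s ->
  x `^ p + mu_next p n m * s `^ p <=
  m * t `^ p + ((1 - p) / p) `^ p * s `^ p.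
Proof.
move=> p01 n0 m0 r0 x0 s0 tE; have /andP[p0 p1] := p01.
rewrite /mu_next mulrDl addrA lerD2r.
have y0 : 0 <= n.+1%:R * s by rewrite mulr_ge0.
have nn0 : n%:R != 0 :> R by rewrite pnatr_eq0 -lt0n.
have npn0 : n%:R `^ p != 0 by rewrite powR_eq0 (negbTE nn0).
have t0 : 0 <= t by rewrite -(pmulr_rge0 _ (_ : 0 < n%:R)) ?ltr0n// tE addr_ge0.
have := powR_hoelder_step p01 r0 x0 y0.
rewrite addrC [X in X `^ (1 - p) * (x + _) `^ p]addrC.
rewrite mu_radicandE// -powRrM mulVf ?powRr1 ?divr_ge0 ?powR_ge0//; last first.
  by rewrite subr_eq0 gt_eqF.
rewrite -tE !powRM//. rewrite [_ / _ * _]mulrA divfK// addrC.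
by rewrite mulrA (mulrC (mu_radicand _ _ _ `^ _)).
Qed.

(** With q = p/(1-p) and d = 1/(2q) one has lam k = q^(1-p) (k + d), and the
    bound lam (n+1) <= mu_next (lam n) unfolds to [ratio_powR_ge] at x = n.  The
    assumption 1/3 <= p says d <= 1. *)
Lemma mu_next_ge (R : realType) (p : R) (n : nat) : 1 / 3 <= p < 1 ->
  (0 < n)%N ->
  let lam k := (p / (1 - p)) `^ (1 - p) * k%:R + 1 / 2 * (1 / p - 1) `^ p in
  [/\ 0 <= lam n, 0 <= mu_radicand p n (lam n) & lam n.+1 <= mu_next p n (lam n)].
Proof.
move=> /andP[p3 p1] n0 lam.
have p0 : 0 < p by lra.
have e0 : 0 < 1 - p by lra.
pose q := p / (1 - p); pose d := (1 - p) / (2 * p).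
have q0 : 0 < q by rewrite divr_gt0.
have d0 : 0 < d by rewrite divr_gt0 ?mulr_gt0.
have d1 : d <= 1 by rewrite ler_pdivrMr ?mulr_gt0//; lra.
have qd : 2 * q * d = 1.
  by rewrite /q /d; field; rewrite !gt_eqF.
have qinv : q^-1 = (1 - p) / p by rewrite /q invf_div.
have qinv' : q^-1 = 1 / p - 1.
  by rewrite qinv; field; rewrite gt_eqF.
have q1 : (1 - p)^-1 = 1 + q by rewrite /q; field; rewrite gt_eqF.
have cE : (q^-1) `^ p = 2 * (q `^ (1 - p) * d).
  rewrite powR_inv ?ltW// powRD ?(gt_eqF q0) ?implybT// powRr1 ?(ltW q0)//.
  rewrite (_ : 2 * _ = 2 * q * d * q `^ (- p)); last by ring.
  by rewrite qd mul1r.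
have lamE k : lam k = q `^ (1 - p) * (k%:R + d).
  by rewrite /lam -/q -qinv' cE; field.
have lam0 k : 0 <= lam k by rewrite lamE mulr_ge0 ?powR_ge0// addr_ge0// ltW.
have nR : 0 < n%:R :> R by rewrite ltr0n.
have radE : mu_radicand p n (lam n) + 1 =
    q * (n%:R * ((n%:R + d) / n%:R) `^ (1 + q)).
  rewrite mu_radicandE// lamE.
  rewrite (_ : _ / _ = (q * n%:R) `^ (1 - p) * ((n%:R + d) / n%:R)); last first.
    rewrite powRM ?(ltW q0)// [n%:R `^ (1 - p)]powRB ?(gt_eqF nR) ?implybT//.
    rewrite powRr1 ?(ltW nR)//; field.
    by rewrite !gt_eqF// powR_gt0.
  rewrite powRM ?powR_ge0 ?divr_ge0 ?addr_ge0 ?(ltW d0)// -powRrM mulfV ?gt_eqF//.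
  have qn0 : 0 <= q * n%:R by rewrite mulr_ge0// ltW.
  by rewrite (powRr1 qn0) q1 mulrA.
set rho := (n%:R + 1 - d) / (n%:R + 1).
have rho0 : 0 <= rho by rewrite divr_ge0//; lra.
have n10 : 0 < n%:R + 1 :> R by lra.
have qn10 : 0 <= q * (n%:R + 1) by rewrite mulr_ge0// ltW.
have radge : q * (n%:R + 1) * rho `^ (1 + q) <= mu_radicand p n (lam n).
  have d01 : 0 < d <= 1 by rewrite d0.
  have := ler_wpM2l (ltW q0) (ratio_powR_ge d01 qd nR).
  by rewrite -/rho -radE; lra.
have low0 : 0 <= q * (n%:R + 1) * rho `^ (1 + q).
  by rewrite mulr_ge0 ?powR_ge0.
split => //; first exact: le_trans radge.
have := @ge0_ler_powR _ (1 - p) (ltW e0) _ _ low0 (le_trans low0 radge) radge.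
rewrite -[1 + q]q1 (powRM _ qn10) ?powR_ge0//.
rewrite -powRrM mulVf ?gt_eqF// (powRr1 rho0) (powRM _ (ltW q0) (ltW n10)).
move=> /(ler_wpM2l (powR_ge0 n.+1%:R p)) le1.
rewrite /mu_next -qinv cE lamE.
(* the added summand is c = (1/q)^p, rewritten by [cE] *)
rewrite -(lerD2r (2 * (q `^ (1 - p) * d))) in le1.
apply: le_trans le1; rewrite -natr1.
rewrite [(_ + 1) `^ (1 - p)]powRB ?(gt_eqF n10) ?implybT// powRr1 ?(ltW n10)//.
rewrite le_eqVlt /rho; apply/orP; left; apply/eqP.
have P0 : (n%:R + 1) `^ p != 0 by rewrite gt_eqF// powR_gt0.
have N0 : n%:R + 1 != 0 :> R by rewrite gt_eqF.
move: (q `^ (1 - p)) (_ `^ p) P0 (d) => a P P0 d'.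
by field; rewrite P0 N0.
Qed.

(** * The tail inequality *)

Lemma tail_mean_rec (R : realType) (x : nat -> R) (n : nat) :
  (0 < n)%N ->
  (forall k : nat, (1 <= k)%N -> cvgn (fun N => \sum_(k <= i < N) x i)) ->
  n%:R * tail_mean x n = x n + n.+1%:R * tail_mean x n.+1.
Proof.
move=> n0 xcvg; rewrite /tail_mean !mulrA !mulr1 !divff ?pnatr_eq0 -?lt0n// !mul1r.
apply/cvg_lim => //.
have : (fun N => x n + \sum_(n.+1 <= i < N) x i) @ \oo -->
    x n + limn (fun N => \sum_(n.+1 <= i < N) x i).
  by apply: cvgD; [exact: cvg_cst | exact: xcvg].
apply: cvg_trans; apply: near_eq_cvg; near=> N.
by rewrite -big_ltn//; near: N; exact: nbhs_infty_gt.
Unshelve. all: by end_near. Qed.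

Lemma tail_mean_ge0 (R : realType) (x : nat -> R) (n : nat) :
  (0 < n)%N -> (forall k : nat, (1 <= k)%N -> 0 < x k) ->
  cvgn (fun N => \sum_(n <= i < N) x i) -> 0 <= tail_mean x n.
Proof.
move=> n0 x0 xcvg; rewrite /tail_mean mulr_ge0 ?divr_ge0//.
apply: limr_ge => //; apply: nearW => N.
rewrite big_nat_cond sumr_ge0// => i /andP[/andP[ni _] _].
by rewrite ltW// x0// (leq_trans n0).
Qed.

(** The finite form of the inequality: the sum of the powers of the tail beyond N
    is replaced by a multiple of the N-th tail mean, and 1/C_p is moved to the right. *)
Definition partial_bound (R : realType) (p : R) (x : nat -> R) (N : nat) (m : R) :=
  \sum_(1 <= k < N) x k `^ p + m * tail_mean x N `^ p <=
  ((1 - p) / p) `^ p * \sum_(1 <= k < N.+1) tail_mean x k `^ p.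

Lemma partial_bound_step (R : realType) (p : R) (x : nat -> R) (N : nat) (m : R) :
  0 < p < 1 -> admissible p x -> (0 < N)%N -> 0 <= m ->
  0 <= mu_radicand p N m -> partial_bound p x N m ->
  partial_bound p x N.+1 (mu_next p N m).
Proof.
move=> p01 [x0 xcvg _ _] N0 m0 r0; rewrite /partial_bound => IH.
rewrite big_nat_recr//= [in leRHS]big_nat_recr//= mulrDr -addrA.
apply: le_trans (lerD IH (lexx _)); rewrite -addrA lerD2l.
apply: mu_next_step => //; first by rewrite ltW// x0.
  by apply: tail_mean_ge0 => //; exact: xcvg.
exact: tail_mean_rec.
Qed.

Lemma partial_bound_le (R : realType) (p : R) (x : nat -> R) (N : nat) (m m' : R) :
  m' <= m -> partial_bound p x N m -> partial_bound p x N m'.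
Proof.
by move=> m'm; apply: le_trans; rewrite lerD2l ler_wpM2r ?powR_ge0.
Qed.

Lemma muS (R : realType) (p : R) (n : nat) : (0 < n)%N ->
  mu p n.+1 = mu_next p n (mu p n).
Proof. by case: n. Qed.

Lemma mu_ge0 (R : realType) (p : R) (n : nat) : 0 <= mu p n.
Proof.
by case: n => [|[|n]]//=; rewrite ?powR_ge0// addr_ge0 ?mulr_ge0 ?powR_ge0.
Qed.

Lemma partial_bound_mu (R : realType) (p : R) (x : nat -> R) (n : nat) :
  0 < p < 1 -> admissible p x -> (0 < n)%N -> mu_defined p n ->
  partial_bound p x n (mu p n).
Proof.
move=> p01 adm; elim: n => // -[_ _ _|n IH _ mud].
  by rewrite /partial_bound big_geq// big_nat1 add0r.
rewrite muS//; apply: partial_bound_step => //; first exact: mu_ge0.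
  by apply: mud => /=.
by apply: IH => // m /andP[m1 mn]; apply: mud; rewrite m1 ltnS ltnW.
Qed.

(** Dropping the nonnegative term m * (tail mean)^p and letting N tend to
    infinity. *)
Lemma partial_bound_tail_inequality (R : realType) (p : R) (x : nat -> R) (n0 : nat) :
  0 < p < 1 -> admissible p x ->
  (forall N, (n0 <= N)%N -> exists2 m, 0 <= m & partial_bound p x N m) ->
  tail_inequality p ((p / (1 - p)) `^ p) x.
Proof.
move=> /andP[p0 p1] [x0 xcvg Tcvg xpcvg] bnd; rewrite /tail_inequality.
have e0 : 0 < 1 - p by rewrite subr_gt0.
set L := limn (fun N => \sum_(1 <= n < N) tail_mean x n `^ p).
have cC : (p / (1 - p)) `^ p * ((1 - p) / p) `^ p = 1.
  rewrite -powRM ?divr_ge0 ?(ltW p0) ?(ltW e0)//.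
  by rewrite mulf_div (mulrC p) divff ?powR1// mulf_neq0 ?gt_eqF.
rewrite (_ : L = (p / (1 - p)) `^ p * (((1 - p) / p) `^ p * L)); last first.
  by rewrite mulrA cC mul1r.
rewrite ler_wpM2l ?powR_ge0//.
apply: limr_le => //; near=> N.
have [m m0 bN] : exists2 m, 0 <= m & partial_bound p x N m.
  by apply: bnd; near: N; exact: nbhs_infty_ge.
apply: (@le_trans _ _ (((1 - p) / p) `^ p * \sum_(1 <= k < N.+1) tail_mean x k `^ p)).
  by apply: le_trans bN; rewrite lerDl mulr_ge0 ?powR_ge0.
rewrite ler_wpM2l ?powR_ge0//.
apply: (nondecreasing_cvgn_le _ Tcvg N.+1).
by apply: nondecreasing_series => k _ _; exact: powR_ge0.
Unshelve. all: by end_near. Qed.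

(** Up to n0 the coefficients are those of [mu]; at n0 they are lowered to the
    affine sequence lam, which then reproduces itself and is defined for all N. *)
Lemma tail_inequality_of_mu (R : realType) (p : R) (n0 : nat) (x : nat -> R) :
  1 / 3 <= p < 1 -> (1 <= n0)%N -> mu_defined p n0 ->
  (p / (1 - p)) `^ (1 - p) * n0%:R + 1 / 2 * (1 / p - 1) `^ p <= mu p n0 ->
  admissible p x -> tail_inequality p ((p / (1 - p)) `^ p) x.
Proof.
move=> p3 n01 mud mun0 adm.
have p01 : 0 < p < 1 by lra.
pose lam k := (p / (1 - p)) `^ (1 - p) * k%:R + 1 / 2 * (1 / p - 1) `^ p.
have lamP N : (n0 <= N)%N -> partial_bound p x N (lam N).
  elim: N => [|N IH]; first by rewrite leqn0 => /eqP n00; rewrite n00 in n01.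
  rewrite leq_eqVlt => /predU1P[<-|].
    exact/(partial_bound_le mun0)/partial_bound_mu.
  rewrite ltnS => n0N; have N0 : (0 < N)%N by exact: leq_trans n0N.
  have [l0 r0 lS] := mu_next_ge p3 N0.
  by apply: (partial_bound_le lS); apply: partial_bound_step => //; exact: IH.
apply: (@partial_bound_tail_inequality _ _ _ n0) => // N n0N.
exists (lam N); last exact: lamP.
by have [] := mu_next_ge p3 (leq_trans n01 n0N).
Qed.

(** * Optimality of the constant *)

(** The convex function x^(-s) lies above its tangent at b. *)
Lemma powR_tangent_le (R : realType) (s a b : R) : 0 <= s -> 0 < a -> 0 < b ->
  b `^ (- s) + s * (b - a) * b `^ (- s - 1) <= a `^ (- s).
Proof.
move=> s0 a0 b0.
have r0 : 0 < a / b by rewrite divr_gt0.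
have ln_le : ln (a / b) <= a / b - 1.
  by rewrite -[X in ln X](subrKC 1) le_ln1Dx//; lra.
have exp_ge : 1 + s * (1 - a / b) <= (a / b) `^ (- s).
  rewrite /powR gt_eqF//; apply: le_trans (expR_ge1Dx _).
  by rewrite lerD2l mulNr -mulrN ler_wpM2l//; lra.
have -> : a `^ (- s) = b `^ (- s) * (a / b) `^ (- s).
  by rewrite -powRM ?(ltW b0) ?(ltW r0)// mulrC divfK// gt_eqF.
apply: le_trans (ler_wpM2l (powR_ge0 _ _) exp_ge).
rewrite powRB ?(gt_eqF b0) ?implybT// powRr1 ?(ltW b0)//.
by rewrite le_eqVlt; apply/orP; left; apply/eqP; field; rewrite gt_eqF.
Qed.

Lemma cvg_natr_powRN (R : realType) (s : R) : 0 < s ->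
  (fun N => N%:R `^ (- s) : R) @ \oo --> (0 : R).
Proof.
move=> s0; apply/cvgrPdist_le => e e0; near=> N.
rewrite sub0r normrN ger0_norm ?powR_ge0//.
have N0 : 0 < N%:R :> R by rewrite ltr0n; near: N; exact: nbhs_infty_gt.
have eN : e `^ (- s^-1) <= N%:R by near: N; exact: nbhs_infty_ger.
rewrite powRN -[leRHS]invrK lef_pV2 ?posrE ?invr_gt0 ?powR_gt0//.
have -> : e^-1 = (e `^ (- s^-1)) `^ s.
  by rewrite -powRrM mulNr mulVf ?gt_eqF// powR_inv1// ltW.
by rewrite ge0_ler_powR ?nnegrE ?powR_ge0// ltW.
Unshelve. all: by end_near. Qed.

Lemma nonneg_series_cvg (R : realType) (u : nat -> R) (M : R) :
  (forall n, (1 <= n)%N -> 0 <= u n) ->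
  (forall N, \sum_(1 <= n < N) u n <= M) ->
  cvgn (fun N => \sum_(1 <= n < N) u n).
Proof.
move=> u0 uM; apply: nondecreasing_is_cvgn.
  by apply: nondecreasing_series => n n1 _; exact: u0.
by exists M => _ [N _ <-].
Qed.

(** Chosen so that the tail sums telescope to n^(-s). *)
Definition extremal (R : realType) (s : R) (n : nat) : R :=
  n%:R `^ (- s) - n.+1%:R `^ (- s).

Lemma extremal_ge (R : realType) (s : R) (n : nat) : 0 <= s -> (0 < n)%N ->
  s * n.+1%:R `^ (- s - 1) <= extremal s n.
Proof.
move=> s0 n0; rewrite lerBrDl.
have := @powR_tangent_le R s n%:R n.+1%:R s0.
by rewrite !ltr0n => /(_ n0 isT); rewrite -natr1 (addrC n%:R) addrK mulr1 addrC natr1.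
Qed.

Lemma extremal_le (R : realType) (s : R) (n : nat) : 0 <= s -> (0 < n)%N ->
  extremal s n <= s * n%:R `^ (- s - 1).
Proof.
move=> s0 n0; rewrite lerBlDr addrC -lerBlDr.
have := @powR_tangent_le R s n.+1%:R n%:R s0.
rewrite !ltr0n => /(_ isT n0); rewrite -[in s * _]natr1.
by rewrite opprD addNKr mulrN1 mulNr.
Qed.

Lemma sum_extremal (R : realType) (s : R) (m N : nat) : (m <= N)%N ->
  \sum_(m <= n < N) extremal s n = m%:R `^ (- s) - N%:R `^ (- s) :> R.
Proof.
by move=> mN; rewrite (telescope_sumr_eq (fun n => - n%:R `^ (- s))) => [|//|k _];
  rewrite /extremal opprK addrC.
Qed.

Lemma zeta_psum_shift (R : realType) (t : R) (N : nat) :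
  \sum_(1 <= n < N.+2) n%:R `^ t = 1 + \sum_(1 <= n < N.+1) n.+1%:R `^ t :> R.
Proof. by rewrite big_ltn// powR1 big_add1. Qed.

(** Comparison with the telescoping series of [extremal t] from above; the
    term n = 1 has to be split off because the comparison shifts the index. *)
Lemma zeta_psum_le (R : realType) (t : R) (N : nat) : 0 < t ->
  \sum_(1 <= n < N) n%:R `^ (- t - 1) <= 1 + t^-1 :> R.
Proof.
move=> t0; have b0 : 0 <= 1 + t^-1 by rewrite addr_ge0// invr_ge0 ltW.
case: N => [|[|N]]; [by rewrite big_geq | by rewrite big_geq |].
rewrite zeta_psum_shift lerD2l.
apply: (@le_trans _ _ (t^-1 * \sum_(1 <= n < N.+1) extremal t n)).
  rewrite mulr_sumr; apply: ler_sum_nat => n /andP[n1 _].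
  by rewrite ler_pdivlMl// extremal_ge// ltW.
by rewrite sum_extremal// powR1 ler_piMr ?invr_ge0 ?(ltW t0)// gerBl powR_ge0.
Qed.

Lemma zeta_cvg (R : realType) (t : R) : 0 < t ->
  cvgn (fun N => \sum_(1 <= n < N) n%:R `^ (- t - 1) : R).
Proof.
move=> t0; apply: (@nonneg_series_cvg _ _ (1 + t^-1)) => [n _|N].
  exact: powR_ge0.
exact: zeta_psum_le.
Qed.

(** Comparison with the telescoping series of [extremal t] from below; this is
    what makes the series arbitrarily large as t tends to 0. *)
Lemma zeta_ge (R : realType) (t : R) : 0 < t ->
  t^-1 <= limn (fun N => \sum_(1 <= n < N) n%:R `^ (- t - 1) : R).
Proof.
move=> t0.
have cv : (fun N => t^-1 * (1 - N%:R `^ (- t)) : R) @ \oo --> (t^-1 * (1 - 0) : R).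
  apply: cvgM; first exact: cvg_cst.
  by apply: cvgB; [exact: cvg_cst | exact: cvg_natr_powRN].
rewrite subr0 mulr1 in cv; rewrite -(cvg_lim _ cv)//.
apply: ler_lim; [by apply: cvgP cv | exact: zeta_cvg |].
near=> N; have N1 : (1 <= N)%N by near: N; exact: nbhs_infty_ge.
have <- : \sum_(1 <= n < N) extremal t n = 1 - N%:R `^ (- t) :> R.
  by rewrite sum_extremal// powR1.
rewrite mulr_sumr; apply: ler_sum_nat => n /andP[n1 _].
by rewrite ler_pdivrMl// extremal_le// ltW.
Unshelve. all: by end_near. Qed.

Lemma extremal_sum_cvg (R : realType) (s : R) (n : nat) : 0 < s ->
  (fun N => \sum_(n <= k < N) extremal s k) @ \oo --> (n%:R `^ (- s) : R).
Proof.
move=> s0; rewrite -[n%:R `^ (- s)]subr0.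
apply: (@cvg_trans _ ((fun N => n%:R `^ (- s) - N%:R `^ (- s) : R) @ \oo)); last first.
  by apply: cvgB; [exact: cvg_cst | exact: cvg_natr_powRN].
apply: near_eq_cvg; near=> N; rewrite sum_extremal//.
by near: N; exact: nbhs_infty_ge.
Unshelve. all: by end_near. Qed.

Lemma tail_mean_extremal (R : realType) (s : R) (n : nat) : 0 < s -> (0 < n)%N ->
  tail_mean (extremal s) n = n%:R `^ (- s - 1).
Proof.
move=> s0 n0; rewrite /tail_mean (cvg_lim _ (@extremal_sum_cvg _ _ n s0))//.
rewrite powRB ?pnatr_eq0 -?lt0n ?n0 ?implybT// powRr1//.
by rewrite mul1r mulrC.
Qed.

(** The exponent s = (1+t)/p - 1 is chosen to make the p-th powers of the tail
    means the terms of the zeta series at 1 + t. *)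
Lemma tail_mean_extremal_powR (R : realType) (p t : R) (n : nat) :
  0 < p -> 0 < (1 + t) / p - 1 -> (0 < n)%N ->
  tail_mean (extremal ((1 + t) / p - 1)) n `^ p = n%:R `^ (- t - 1).
Proof.
move=> p0 s0 n0; rewrite tail_mean_extremal// -powRrM; congr (_ `^ _).
by field; rewrite gt_eqF.
Qed.

Lemma extremal_admissible (R : realType) (p t : R) : 0 < p < 1 -> 0 < t ->
  admissible p (extremal ((1 + t) / p - 1)).
Proof.
move=> /andP[p0 p1] t0.
have s0 : 0 < (1 + t) / p - 1 by rewrite subr_gt0 ltr_pdivlMr//; lra.
have ext0 n : (1 <= n)%N -> 0 < extremal ((1 + t) / p - 1) n.
  move=> n1; apply: lt_le_trans (extremal_ge (ltW s0) n1).
  by rewrite mulr_gt0// powR_gt0.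
split => //.
- by move=> n _; exact: cvgP (extremal_sum_cvg s0).
- apply: (@nonneg_series_cvg _ _ (1 + t^-1)) => [n _|N]; first exact: powR_ge0.
  apply: le_trans (zeta_psum_le N t0); apply: ler_sum_nat => n /andP[n1 _].
  by rewrite tail_mean_extremal_powR.
- apply: (@nonneg_series_cvg _ _ (((1 + t) / p - 1) `^ p * (1 + t^-1))) => [n _|N].
    exact: powR_ge0.
  apply: le_trans (ler_wpM2l (powR_ge0 _ _) (zeta_psum_le N t0)).
  rewrite mulr_sumr; apply: ler_sum_nat => n /andP[n1 _].
  rewrite -(tail_mean_extremal_powR p0 s0 n1) -powRM ?(ltW s0)//; last first.
    by rewrite tail_mean_extremal// powR_ge0.
  rewrite ge0_ler_powR ?nnegrE ?(ltW p0) ?(ltW (ext0 _ n1))//.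
    by rewrite tail_mean_extremal// mulr_ge0 ?powR_ge0// (ltW s0).
  by rewrite tail_mean_extremal// extremal_le// ltW.
Qed.

Lemma extremal_powR_sum_ge (R : realType) (p t : R) : 0 < p < 1 -> 0 < t ->
  ((1 + t) / p - 1) `^ p *
    (limn (fun N => \sum_(1 <= n < N) n%:R `^ (- t - 1) : R) - 1) <=
  limn (fun N => \sum_(1 <= n < N) extremal ((1 + t) / p - 1) n `^ p).
Proof.
move=> p01 t0; have [ext0 _ _ xcvg] := extremal_admissible p01 t0.
have /andP[p0 p1] := p01.
have s0 : 0 < (1 + t) / p - 1 by rewrite subr_gt0 ltr_pdivlMr//; lra.
set s := (1 + t) / p - 1 in s0 ext0 xcvg *.
set Z := limn (fun N => \sum_(1 <= n < N) n%:R `^ (- t - 1) : R).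
have Zcv : (fun N => s `^ p * (\sum_(1 <= n < N.+2) n%:R `^ (- t - 1) - 1) : R) @ \oo -->
    s `^ p * (Z - 1).
  apply: cvgM; first exact: cvg_cst.
  apply: cvgB; last exact: cvg_cst.
  rewrite (cvg_shiftS (fun N => \sum_(1 <= n < N.+1) n%:R `^ (- t - 1) : R)).
  rewrite (cvg_shiftS (fun N => \sum_(1 <= n < N) n%:R `^ (- t - 1) : R)).
  exact: zeta_cvg.
rewrite -(cvg_lim _ Zcv)//; apply: limr_le; first exact: cvgP Zcv.
apply: nearW => N; rewrite zeta_psum_shift [1 + _]addrC addrK.
apply: (@le_trans _ _ (\sum_(1 <= n < N.+1) extremal s n `^ p)); last first.
  apply: (nondecreasing_cvgn_le _ xcvg N.+1).
  by apply: nondecreasing_series => k _ _; exact: powR_ge0.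
rewrite mulr_sumr; apply: ler_sum_nat => n /andP[n1 _].
have n20 : 0 < n.+1%:R :> R by rewrite ltr0n.
rewrite -(tail_mean_extremal_powR p0 s0 (ltn0Sn n)) -powRM ?(ltW s0)//; last first.
  by rewrite tail_mean_extremal// powR_ge0.
rewrite tail_mean_extremal// ge0_ler_powR ?nnegrE ?mulr_ge0 ?powR_ge0 ?(ltW p0) ?(ltW s0)//.
  by rewrite ltW// ext0.
by rewrite extremal_ge// ltW.
Qed.

(** Write Z for the zeta series at 1 + t.  The two sides for [extremal s] are Z and
    at least s^p (Z - 1), and C s^p >= D := C (1/p - 1)^p > 1.  As Z >= 1/t, the
    choice of t makes D (Z - 1) exceed Z. *)
Lemma tail_constant_optimal (R : realType) (p C : R) : 0 < p < 1 ->
  (p / (1 - p)) `^ p < C ->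
  exists x : nat -> R, admissible p x /\ ~ tail_inequality p C x.
Proof.
move=> p01 ltC; have /andP[p0 p1] := p01.
have e0 : 0 < 1 - p by rewrite subr_gt0.
pose D := C * (1 / p - 1) `^ p.
have q0 : 0 < 1 / p - 1 by rewrite subr_gt0 ltr_pdivlMr// mul1r.
have D1 : 1 < D.
  have -> : 1 = (p / (1 - p)) `^ p * (1 / p - 1) `^ p :> R.
    rewrite -powRM ?(ltW q0) ?divr_ge0 ?(ltW p0) ?(ltW e0)//.
    by rewrite [X in X `^ _](_ : _ = 1) ?powR1//; field; rewrite !gt_eqF.
  by rewrite ltr_pM2r// powR_gt0.
(* half of the value (D - 1) / D at which 1/t would give D (1/t - 1) = 1/t *)
pose t := (D - 1) / (2 * D).
have t0 : 0 < t by rewrite divr_gt0//; lra.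
exists (extremal ((1 + t) / p - 1)); split; first exact: extremal_admissible.
rewrite /tail_inequality.
set Z := limn (fun N => \sum_(1 <= n < N) n%:R `^ (- t - 1) : R).
have -> : (fun N => \sum_(1 <= n < N) tail_mean (extremal ((1 + t) / p - 1)) n `^ p) =
    (fun N => \sum_(1 <= n < N) n%:R `^ (- t - 1)).
  apply/funext => N; apply: eq_big_nat => n /andP[n1 _].
  rewrite tail_mean_extremal_powR// subr_gt0 ltr_pdivlMr//; lra.
apply/negP; rewrite -ltNge -/Z.
have Zge : 2 * D / (D - 1) <= Z by rewrite -[leLHS]invf_div zeta_ge.
have C0 : 0 < C by apply: le_lt_trans ltC; exact: powR_ge0.
apply: (@lt_le_trans _ _ (D * (Z - 1))).
  have : 2 * D <= Z * (D - 1) by rewrite -ler_pdivrMr// subr_gt0.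
  by lra.
have Z1 : 0 <= Z - 1.
  have : 2 * D <= Z * (D - 1) by rewrite -ler_pdivrMr// subr_gt0.
  by nra.
rewrite /D -mulrA ler_pM2l//.
apply: le_trans (extremal_powR_sum_ge p01 t0).
rewrite ler_wpM2r// ge0_ler_powR ?nnegrE ?(ltW p0) ?(ltW q0)//.
  by rewrite subr_ge0 ler_pdivlMr// ; lra.
by rewrite lerD2r ler_pM2r ?invr_gt0//; lra.
Qed.

(** * Conclusion *)

Theorem theorem1p11 (R : realType) (p : R) (hp : 1 / 3 <= p < 1)
  (hmu : exists n0 : nat,
    [/\ (1 <= n0)%N,
        mu_defined p n0
      & mu p n0 >= (p / (1 - p)) `^ (1 - p) * n0%:R
                   + 1 / 2 * (1 / p - 1) `^ p]) :
  (forall x : nat -> R, admissible p x ->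
     tail_inequality p ((p / (1 - p)) `^ p) x) /\
  (forall C : R, (p / (1 - p)) `^ p < C ->
     exists x : nat -> R, admissible p x /\ ~ tail_inequality p C x).
Proof.
have p01 : 0 < p < 1 by lra.
case: hmu => n0 [n01 mud mun0]; split=> [x adm|C ltC].
  exact: (tail_inequality_of_mu hp n01 mud mun0 adm).
exact: tail_constant_optimal.
Qed.
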